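(* Let $X$ be a $G$-topological group with operations, where $G$ is a regular method preserving the $G$-convergence of subsequences. Let $\mathcal{B}_e$ be a fundamental system of $G$-open neighbourhoods of the identity $e$, and for each $x\in X$ let $\mathcal{B}_x=\{xU: U\in\mathcal{B}_e\}$. Then the family $\mathcal{B}=\bigcup_{x\in X}\mathcal{B}_x$ is a base for a topology $\sigma$ on $X$. Thus $X$ is a $G$-topology, that is, the family $\tau_G$ of all $G$-open subsets of $X$ is a topology on $X$.
   Context: A group with operations is a group $X$ (not necessarily abelian; additively $0,-,+$) with a set $\Omega=\Omega_0\cup\Omega_1\cup\Omega_2$ of operations ($\Omega_i$ the $i$-ary ones), where $\Omega_0=\{0\}$, $-\in\Omega_1$, $+\in\Omega_2$, such that, with $\Omega_1'=\Omega_1\setminus\{-\}$ and $\Omega_2'=\Omega_2\setminus\{+\}$: if $\star\in\Omega_2'$ then the operation $x\star^\circ y=y\star x$ is in $\Omega_2'$; $x\star(y+z)=x\star y+x\star z$; $\omega(x+y)=\omega(x)+\omega(y)$; and $\omega(x)\star y=\omega(x\star y)$ for all $\omega\in\Omega_1'$, $\star\in\Omega_2'$. Here the group operation is written multiplicatively, with identity $e$ and inverse $x^{-1}$. Let $X$ carry a Hausdorff topology $\tau$. $s(X)$ is the set of sequences in $X$, $c(X)$ the set of convergent ones. A method is a function $G:c_G(X)\to X$ with $c_G(X)\subset s(X)$. It is regular if $c(X)\subset c_G(X)$ and $G(\mathbf{x})=\lim\mathbf{x}$ for $\mathbf{x}\in c(X)$. It preserves the $G$-convergence of subsequences if, whenever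 $\mathbf{x}\in c_G(X)$ with $G(\mathbf{x})=l$, every subsequence $\mathbf{x}'$ of $\mathbf{x}$ is in $c_G(X)$ with $G(\mathbf{x}')=l$. On $X\times X$ the product method is used: $(\mathbf{x},\mathbf{y})\in c_G(X\times X)$ iff $\mathbf{x},\mathbf{y}\in c_G(X)$, and then $G(\mathbf{x},\mathbf{y})=(G(\mathbf{x}),G(\mathbf{y}))$. A map $f$ is $G$-continuous if for every sequence $\mathbf{x}$ in the domain of the method, $f(\mathbf{x})$ is in the domain of the method on the target and $G(f(\mathbf{x}))=f(G(\mathbf{x}))$. $X$ (with $\tau$) is a $G$-topological group with operations if it is a group with operations such that the multiplication map $X\times X\to X$ and the inverse map $X\to X$ are $G$-continuous. $A\subset X$ is $G$-closed if $G(\mathbf{x})\in A$ for every $\mathbf{x}\in s(A)\cap c_G(X)$, and $G$-open if $X\setminus A$ is $G$-closed. A $G$-open neighbourhood of $a$ is a $G$-open set containing $a$; a family $\mathcal{B}_a$ of $G$-open neighbourhoods of $a$ is a fundamental system of $G$-open neighbourhoods of $a$ if every $G$-open neighbourhood $U$ of $a$ contains some $V\in\mathcal{B}_a$. *)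

(* Defs.v *)
From HB Require Import structures.
From mathcomp Require Import all_boot.
From mathcomp Require Import all_classical.
From mathcomp Require Import topology sequences.

Set Implicit Arguments.
Unset Strict Implicit.
Unset Printing Implicit Defensive.

Local Open Scope classical_set_scope.

(* A group that also carries a topology, with no compatibility required:
   multiplication and inversion need not be continuous for the topology. *)
#[short(type="preTopologicalGroupType")]
HB.structure Definition PreTopologicalGroup := {X of Topological X & Group X}.

(* The operations of each arity are sets of functions, so that the primed sets
   of the usual presentation are obtained by removing inversion from [Omega1]
   and multiplication from [Omega2]. The group law is written multiplicatively
   and is not assumed commutative. *)
Record group_with_operations (X : groupType) (Omega0 : set X)
    (Omega1 : set (X -> X)) (Omega2 : set (X -> X -> X)) : Prop := {
  gwo_nullary : Omega0 = [set 1%g];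
  gwo_inv : Omega1 (fun x => x^-1)%g;
  gwo_mul : Omega2 (fun x y => x * y)%g;
  gwo_opp : forall star, (Omega2 `\ (fun x y => x * y)%g) star ->
    (Omega2 `\ (fun x y => x * y)%g) (fun x y => star y x);
  gwo_distr : forall star, (Omega2 `\ (fun x y => x * y)%g) star ->
    forall x y z, star x (y * z)%g = (star x y * star x z)%g;
  gwo_morph : forall omega, (Omega1 `\ (fun x => x^-1)%g) omega ->
    forall x y, omega (x * y)%g = (omega x * omega y)%g;
  gwo_compat : forall omega star,
    (Omega1 `\ (fun x => x^-1)%g) omega ->
    (Omega2 `\ (fun x y => x * y)%g) star ->
    forall x y, star (omega x) y = omega (star x y) }.

(* A partial function from sequences to points: the values of [method_val]
   outside [method_dom] are junk and are never used. *)
Record method (X : Type) := Method {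
  method_dom : set (nat -> X);
  method_val :> (nat -> X) -> X }.

Definition prod_method (X Y : Type) (G : method X) (H : method Y) :
    method (X * Y) :=
  Method [set z | method_dom G (fst \o z) /\ method_dom H (snd \o z)]
    (fun z => (G (fst \o z), H (snd \o z))).

(* The space need not be pointed, so the limit is expressed by convergence to
   a point instead of [lim]. *)
Definition regular_method (X : topologicalType) (G : method X) :=
  forall (x : nat -> X) (l : X), x @ \oo --> l -> method_dom G x /\ G x = l.

Definition preserves_subsequences (X : Type) (G : method X) :=
  forall x : nat -> X, method_dom G x ->
  forall phi : nat -> nat, {homo phi : m n / (m < n)%N} ->
  method_dom G (x \o phi) /\ G (x \o phi) = G x.

Definition G_continuous (X Y : Type) (G : method X) (H : method Y)
    (f : X -> Y) :=
  forall x : nat -> X, method_dom G x ->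
  method_dom H (f \o x) /\ H (f \o x) = f (G x).

Record G_topological_group_with_operations (X : preTopologicalGroupType)
    (G : method X) (Omega0 : set X) (Omega1 : set (X -> X))
    (Omega2 : set (X -> X -> X)) : Prop := {
  gtg_hausdorff : hausdorff_space X;
  gtg_operations : group_with_operations Omega0 Omega1 Omega2;
  gtg_mul : G_continuous (prod_method G G) G (fun p : X * X => (p.1 * p.2)%g);
  gtg_inv : G_continuous G G (fun x : X => (x^-1)%g) }.

Definition G_closed (X : Type) (G : method X) (A : set X) :=
  forall x : nat -> X, (forall n, A (x n)) -> method_dom G x -> A (G x).

Definition G_open (X : Type) (G : method X) (A : set X) := G_closed G (~` A).

Definition G_open_nbhd (X : Type) (G : method X) (a : X) (U : set X) :=
  G_open G U /\ U a.

Definition fundamental_system (X : Type) (G : method X) (a : X)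
    (B : set (set X)) :=
  B `<=` G_open_nbhd G a /\
  forall U, G_open_nbhd G a U -> exists2 V, B V & V `<=` U.

(* The axioms of the factory [isOpenTopological], as a predicate on families
   of sets; the empty family gives the empty set. *)
Definition is_topology (X : Type) (O : set (set X)) :=
  [/\ O setT, setI_closed O &
    forall F : set (set X), F `<=` O -> O (\bigcup_(U in F) U)].

Definition is_base (X : Type) (O B : set (set X)) :=
  B `<=` O /\
  forall U, O U -> exists2 C, C `<=` B & U = \bigcup_(V in C) V.

Definition left_translates (X : groupType) (B : set (set X)) (x : X) :
    set (set X) :=
  [set [set (x * u)%g | u in U] | U in B].

(* Main.v *)
(** Two [G]-closed sets have a [G]-closed union, since a sequence in the union
    has a subsequence in one of the two sets, with the same [G]-limit. Regularity
    gives constant sequences their [G]-limit, so left translations are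
    [G]-continuous and the translates of a fundamental system at the identity
    form a base of the topology of [G]-open sets itself. *)
Require Import Defs.
From HB Require Import structures.
From mathcomp Require Import all_boot.
From mathcomp Require Import all_classical.
From mathcomp Require Import topology sequences.

Local Open Scope classical_set_scope.

Lemma frequently_subsequence (P : nat -> Prop) :
  (forall N, exists2 n, (N <= n)%N & P n) ->
  exists2 phi : nat -> nat, {homo phi : m n / (m < n)%N} & forall n, P (phi n).
Proof.
move=> freqP.
have /choice[f fP] : forall N, exists n, (N <= n)%N /\ P n.
  by move=> N; have [n Nn Pn] := freqP N; exists n.
(* Each index is chosen at or beyond the successor of the previous one, hence strict growth;
   starting at [f 0] rather than [0] gives [P] at the first index too. *)
exists (fun n => iter n (f \o succn) (f 0%N)).
  apply: homo_ltn; first exact: ltn_trans.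
  by move=> n /=; case: (fP (iter n (f \o succn) (f 0%N)).+1).
by case=> [|n] /=; [case: (fP 0%N)|case: (fP (iter n (f \o succn) (f 0%N)).+1)].
Qed.

Lemma G_closedU (X : Type) (G : method X) (A B : set X) :
  preserves_subsequences G -> G_closed G A -> G_closed G B ->
  G_closed G (A `|` B).
Proof.
move=> subG clA clB x ABx Gx.
have [freqA|] := pselect (forall N, exists2 n, (N <= n)%N & A (x n)).
  have [phi phi_incr Aphi] := frequently_subsequence _ freqA.
  have [Gphi <-] := subG x Gx phi phi_incr.
  by left; apply: clA.
(* Otherwise [x] avoids [A] from index [N] on, so the tail along [addn N] is a subsequence lying in
   [B]. *)
move=> /existsNP[N notA].
have [GN <-] : method_dom G (x \o addn N) /\ G (x \o addn N) = G x.
  by apply: subG => // m n; rewrite ltn_add2l.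
right; apply: clB => // n /=.
case: (ABx (N + n)%N) => // An.
by case: notA; exists (N + n)%N => //; exact: leq_addr.
Qed.

Lemma is_topology_G_open (X : Type) (G : method X) :
  preserves_subsequences G -> is_topology (G_open G).
Proof.
move=> subG; split.
- by move=> x Tx _; case: (Tx 0%N).
- by move=> U V oU oV; rewrite /G_open setCI; exact: G_closedU.
(* If the [G]-limit were in some [U] of [F], then [x], which avoids [U], would contradict that the
   complement of [U] is [G]-closed. *)
- move=> F FO x Fx Gx [U FU UGx].
  by apply: (FO U FU x) => // n Ux; apply: (Fx n); exists U.
Qed.

Lemma G_open_preimage (X Y : Type) (G : method X) (H : method Y) (f : X -> Y)
    (U : set Y) :
  G_continuous G H f -> G_open H U -> G_open G (f @^-1` U).
Proof.
move=> cf oU x Ux Gx; have [Hfx eqfx] := cf x Gx.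
by rewrite /= -eqfx; apply: oU.
Qed.

Lemma G_continuous_mull (X : preTopologicalGroupType) (G : method X) (a : X) :
  regular_method G ->
  G_continuous (prod_method G G) G (fun p : X * X => (p.1 * p.2)%g) ->
  G_continuous G G (fun y : X => (a * y)%g).
Proof.
move=> regG mulG x Gx.
have [Ga eqa] := regG (fun=> a) a (cvg_cst a).
(* Joint [G]-continuity is applied to [x] paired with the constant sequence [a]. *)
have [] := mulG (fun n => (a, x n)) (conj Ga Gx).
by rewrite /= -[fst \o _]/(fun=> a) eqa.
Qed.

(** Writing a translate as a preimage lets [G_open_preimage] show that it is [G]-open. *)
Lemma image_mull (X : groupType) (a : X) (U : set X) :
  [set (a * u)%g | u in U] = (fun y => a^-1 * y)%g @^-1` U.
Proof.
apply/seteqP; split=> [_ [u Uu <-]|y Uy] /=; first by rewrite mulKg.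
by exists (a^-1 * y)%g => //; rewrite mulVKg.
Qed.

Lemma is_base_nbhd (X : Type) (O B : set (set X)) :
  B `<=` O ->
  (forall U a, O U -> U a -> exists V, [/\ B V, V a & V `<=` U]) ->
  is_base O B.
Proof.
move=> BO nbB; split=> // U OU.
(* All members of [B] inside [U] are taken; by hypothesis they reach every point of [U]. *)
exists [set V | B V /\ V `<=` U]; first by move=> V [].
apply/seteqP; split=> [a Ua|a [V [_ VU] Va]]; last exact: VU.
by have [V [BV Va VU]] := nbB U a OU Ua; exists V.
Qed.

Lemma is_base_left_translates (X : preTopologicalGroupType) (G : method X)
    (Be : set (set X)) :
  (forall a : X, G_continuous G G (fun y => (a * y)%g)) ->
  fundamental_system G (1%g : X) Be ->
  is_base (G_open G) (\bigcup_(x in [set: X]) left_translates Be x).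
Proof.
move=> mulG [BeO fundBe]; apply: is_base_nbhd.
  move=> _ [a _ [U BU <-]]; rewrite image_mull.
  by apply: G_open_preimage (mulG _) _; case: (BeO U BU).
move=> U a oU Ua.
(* [U] is pulled back to a neighbourhood of the identity and shrunk there to [V]; the set sought is
   the translate of [V] by [a]. *)
have [|V BV VU] := fundBe ((fun y => a * y)%g @^-1` U).
  by split; [exact: G_open_preimage (mulG a) oU|rewrite /= mulg1].
exists [set (a * u)%g | u in V]; split.
- by exists a => //; exists V.
- by exists 1%g; [case: (BeO V BV)|rewrite mulg1].
- by move=> _ [v Vv <-]; exact: VU.
Qed.

Theorem theorem5p8 (X : preTopologicalGroupType) (G : method X)
    (Omega0 : set X) (Omega1 : set (X -> X)) (Omega2 : set (X -> X -> X))
    (hX : G_topological_group_with_operations G Omega0 Omega1 Omega2)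
    (hreg : regular_method G) (hsub : preserves_subsequences G)
    (Be : set (set X)) (hBe : fundamental_system G (1%g : X) Be) :
  (exists sigma : set (set X), is_topology sigma /\
     is_base sigma (\bigcup_(x in [set: X]) left_translates Be x)) /\
  is_topology (G_open G).
Proof.
have topG := is_topology_G_open X G hsub.
split=> //; exists (G_open G); split=> //.
apply: is_base_left_translates hBe => a.
exact: G_continuous_mull hreg (gtg_mul hX).
Qed.
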